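(* Let $\Bbbk$ be a field of characteristic zero. Let $L$ be the graded Lie algebra over $\Bbbk$ generated by symbols $d$, $a_i$, $b_i$ ($i\ge1$), of homological degrees $|d|=|a_i|=-1$, $|b_i|=0$, subject to the relations \[ [b_n,d]=a_n-\sum_{\substack{i+j=n\\ i,j\ge1}}\frac{i}{i+j}[b_i,a_j]\qquad(n\ge1), \] with the weight grading $w(a_i)=w(b_i)=i$, $w(d)=0$, and let $\widehat U$ be the completion with respect to $w$ of the universal enveloping algebra $U(L)$. Put $\alpha=\sum_{i\ge1}a_i$ and $\beta=\sum_{i\ge1}b_i$ in $\widehat U$, and let $\prec$ and $\beta^{\prec k}$ be as defined in the context. Then the element \[ 1+\sum_{k\ge1}\beta^{\prec k}\in\widehat U \] is group-like for the standard coproduct $\Delta$ of the universal enveloping algebra, and it satisfies \[ \Big(1+\sum_{k\ge1}\beta^{\prec k}\Big)d=(d+\alpha)\Big(1+\sum_{k\ge1}\beta^{\prec k}\Big). \]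
   Context: The relations are homogeneous for $w$, so $w$ induces a grading on $L$ and on $U(L)$; $\widehat U$ is the product of the weight components of $U(L)$. The standard coproduct $\Delta$ is the one for which elements of $L$ are primitive, extended to the completion (with values in the completed tensor product); $u$ is group-like if $\Delta(u)=u\otimes u$ and its counit is $1$. Brackets are graded commutators. On elements of positive weight, define for weight-homogeneous $u,v$ \[ u\prec v=\frac{w(u)}{w(u)+w(v)}\,uv,\qquad u\succ v=\frac{w(v)}{w(u)+w(v)}\,uv, \] extended (bi)linearly and continuously to infinite sums of homogeneous elements of positive weight. The right-normed powers are $\beta^{\prec1}=\beta$ and $\beta^{\prec(n+1)}=\beta\prec\beta^{\prec n}$. *)

(* Defs.v *)
From HB Require Import structures.
From mathcomp Require Import all_boot all_order all_algebra.
From mathcomp Require Import boolp.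

Set Implicit Arguments.
Unset Strict Implicit.
Unset Printing Implicit Defensive.

Import GRing.Theory.
Local Open Scope ring_scope.
Local Open Scope quotient_scope.

Definition bilin (k : fieldType) (M N P : lmodType k) (f : M -> N -> P) :=
  (forall y, linear (f^~ y)) /\ (forall x, linear (f x)).

Section Bilin.
Variables (k : fieldType) (M N P : lmodType k) (f : M -> N -> P).
Hypothesis fb : bilin f.
Let fl y := GRing.isLinear.Build k M P _ (f^~ y) (fb.1 y).
Let fr x := GRing.isLinear.Build k N P _ (f x) (fb.2 x).
Let Fl y : {linear M -> P} := HB.pack (f^~ y) (fl y).
Let Fr x : {linear N -> P} := HB.pack (f x) (fr x).
Lemma bilDl x x' y : f (x + x') y = f x y + f x' y.
Proof. exact: (linearD (Fl y)). Qed.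
Lemma bilDr x y y' : f x (y + y') = f x y + f x y'.
Proof. exact: (linearD (Fr x)). Qed.
Lemma bilZl c x y : f (c *: x) y = c *: f x y.
Proof. exact: (linearZ_LR (Fl y)). Qed.
Lemma bilZr c x y : f x (c *: y) = c *: f x y.
Proof. exact: (linearZ_LR (Fr x)). Qed.
Lemma bil0l y : f 0 y = 0.
Proof. exact: (linear0 (Fl y)). Qed.
Lemma bil0r x : f x 0 = 0.
Proof. exact: (linear0 (Fr x)). Qed.
Lemma bilNl x y : f (- x) y = - f x y.
Proof. exact: (linearN (Fl y)). Qed.
Lemma bilNr x y : f x (- y) = - f x y.
Proof. exact: (linearN (Fr x)). Qed.
Lemma bil_suml I (r : seq I) (Q : pred I) (F : I -> M) y :
  f (\sum_(i <- r | Q i) F i) y = \sum_(i <- r | Q i) f (F i) y.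
Proof. exact: (linear_sum (Fl y)). Qed.
Lemma bil_sumr I (r : seq I) (Q : pred I) x (F : I -> N) :
  f x (\sum_(i <- r | Q i) F i) = \sum_(i <- r | Q i) f x (F i).
Proof. exact: (linear_sum (Fr x)). Qed.
End Bilin.

(* [presented R] is the k-module with O-indexed bilinear operations given by
   generators X and relations R : the quotient of formal terms by the least
   congruence [cong] containing R and the axioms of modules and bilinearity.
   It is used three times: for the Lie algebra (one operation, the bracket),
   for its enveloping algebra (one operation, the product), and for the tensor
   square of the latter (no operation). *)

Section Terms.
Variables (k : fieldType) (O X : Type).

Inductive term :=
| Gen of X
| Zero
| Add of term & term
| Scale of k & term
| Op of O & term & term.

Inductive homog (D : nmodType) (deg : X -> D) : D -> term -> Prop :=
| homog_Gen x : homog deg (deg x) (Gen x)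
| homog_Zero p : homog deg p Zero
| homog_Add p s t : homog deg p s -> homog deg p t -> homog deg p (Add s t)
| homog_Scale p c t : homog deg p t -> homog deg p (Scale c t)
| homog_Op p q o s t :
    homog deg p s -> homog deg q t -> homog deg (p + q) (Op o s t).

Fixpoint eval (M : lmodType k) (op : O -> M -> M -> M) (f : X -> M) t : M :=
  match t with
  | Gen x => f x
  | Zero => 0
  | Add s t => eval op f s + eval op f t
  | Scale c t => c *: eval op f t
  | Op o s t => op o (eval op f s) (eval op f t)
  end.

Variable R : term -> term -> Prop.

Inductive cong : term -> term -> Prop :=
| cong_rel s t : R s t -> cong s t
| cong_refl s : cong s s
| cong_sym s t : cong s t -> cong t s
| cong_trans s t u : cong s t -> cong t u -> cong s u
| cong_Add s s' t t' : cong s s' -> cong t t' -> cong (Add s t) (Add s' t')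
| cong_Scale c s s' : cong s s' -> cong (Scale c s) (Scale c s')
| cong_Op o s s' t t' : cong s s' -> cong t t' -> cong (Op o s t) (Op o s' t')
| cong_addA s t u : cong (Add s (Add t u)) (Add (Add s t) u)
| cong_addC s t : cong (Add s t) (Add t s)
| cong_add0 s : cong (Add Zero s) s
| cong_addN s : cong (Add (Scale (-1) s) s) Zero
| cong_scaleA c d s : cong (Scale c (Scale d s)) (Scale (c * d) s)
| cong_scale1 s : cong (Scale 1 s) s
| cong_scaleDr c s t : cong (Scale c (Add s t)) (Add (Scale c s) (Scale c t))
| cong_scaleDl c d s : cong (Scale (c + d) s) (Add (Scale c s) (Scale d s))
| cong_OpDl o s s' t : cong (Op o (Add s s') t) (Add (Op o s t) (Op o s' t))
| cong_OpDr o s t t' : cong (Op o s (Add t t')) (Add (Op o s t) (Op o s t'))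
| cong_OpZl o c s t : cong (Op o (Scale c s) t) (Scale c (Op o s t))
| cong_OpZr o c s t : cong (Op o s (Scale c t)) (Scale c (Op o s t)).

HB.instance Definition _ := gen_eqMixin term.
HB.instance Definition _ := gen_choiceMixin term.

Definition congb s t := `[< cong s t >].

Lemma congb_refl : reflexive congb.
Proof. by move=> s; apply/asboolP/cong_refl. Qed.
Lemma congb_sym : symmetric congb.
Proof. by move=> s t; apply/asboolP/asboolP; apply: cong_sym. Qed.
Lemma congb_trans : transitive congb.
Proof.
by move=> t s u /asboolP st /asboolP tu; apply/asboolP; apply: cong_trans tu.
Qed.

Canonical cong_equiv := EquivRel congb congb_refl congb_sym congb_trans.

Definition presented := {eq_quot cong_equiv}.
HB.instance Definition _ := Choice.on presented.

Definition pclass (t : term) : presented := \pi_presented t.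
Definition prepr (x : presented) : term := repr x.

Lemma pclassK x : pclass (prepr x) = x.
Proof. exact: reprK. Qed.

Lemma pclassP s t : pclass s = pclass t <-> cong s t.
Proof.
split=> [/eqP|st]; last by apply/eqmodP/asboolP.
by rewrite /pclass => /eqP/eqmodP/asboolP.
Qed.

Lemma preprP t : cong (prepr (pclass t)) t.
Proof. by apply/pclassP; rewrite pclassK. Qed.

Definition pzero := pclass Zero.
Definition padd x y := pclass (Add (prepr x) (prepr y)).
Definition pscale c x := pclass (Scale c (prepr x)).
Definition popp x := pscale (-1) x.
Definition pop o x y := pclass (Op o (prepr x) (prepr y)).

Lemma pclassD s t : pclass (Add s t) = padd (pclass s) (pclass t).
Proof. by apply/esym/pclassP/cong_Add; apply: preprP. Qed.
Lemma pclassZ c s : pclass (Scale c s) = pscale c (pclass s).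
Proof. by apply/esym/pclassP/cong_Scale; apply: preprP. Qed.
Lemma pclassO o s t : pclass (Op o s t) = pop o (pclass s) (pclass t).
Proof. by apply/esym/pclassP/cong_Op; apply: preprP. Qed.

Lemma paddA : associative padd.
Proof.
move=> x y z; rewrite -[x]pclassK -[y]pclassK -[z]pclassK -!pclassD.
exact/pclassP/cong_addA.
Qed.
Lemma paddC : commutative padd.
Proof.
by move=> x y; rewrite -[x]pclassK -[y]pclassK -!pclassD; apply/pclassP/cong_addC.
Qed.
Lemma padd0 : left_id pzero padd.
Proof. by move=> x; rewrite -[x]pclassK -!pclassD; apply/pclassP/cong_add0. Qed.
Lemma paddN : left_inverse pzero popp padd.
Proof.
by move=> x; rewrite -[x]pclassK /popp -pclassZ -!pclassD; apply/pclassP/cong_addN.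
Qed.
HB.instance Definition _ :=
  GRing.isZmodule.Build presented paddA paddC padd0 paddN.

Lemma pscaleA c d x : pscale c (pscale d x) = pscale (c * d) x.
Proof. by rewrite -[x]pclassK -!pclassZ; apply/pclassP/cong_scaleA. Qed.
Lemma pscale1 : left_id 1 pscale.
Proof. by move=> x; rewrite -[x]pclassK -!pclassZ; apply/pclassP/cong_scale1. Qed.
Lemma pscaleDr : right_distributive pscale padd.
Proof.
move=> c x y; rewrite -[x]pclassK -[y]pclassK -pclassD -!pclassZ -pclassD.
exact/pclassP/cong_scaleDr.
Qed.
Lemma pscaleDl x c d : pscale (c + d) x = padd (pscale c x) (pscale d x).
Proof.
by rewrite -[x]pclassK -!pclassZ -pclassD; apply/pclassP/cong_scaleDl.
Qed.
HB.instance Definition _ := GRing.Zmodule_isLmodule.Build k presented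
  pscaleA pscale1 pscaleDr pscaleDl.

Lemma pclass0 : pclass Zero = 0. Proof. by []. Qed.
Lemma pclass_add s t : pclass (Add s t) = pclass s + pclass t.
Proof. exact: pclassD. Qed.
Lemma pclass_scale c s : pclass (Scale c s) = c *: pclass s.
Proof. exact: pclassZ. Qed.

Lemma pop_bilin o : bilin (pop o).
Proof.
split=> x c y z; rewrite -[x]pclassK -[y]pclassK -[z]pclassK.
  rewrite -pclass_scale -pclass_add -!pclassO -pclass_scale -pclass_add.
  apply/pclassP; apply: cong_trans (cong_OpDl _ _ _ _) _.
  by apply: cong_Add (cong_refl _); apply: cong_OpZl.
rewrite -pclass_scale -pclass_add -!pclassO -pclass_scale -pclass_add.
apply/pclassP; apply: cong_trans (cong_OpDr _ _ _ _) _.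
by apply: cong_Add (cong_refl _); apply: cong_OpZr.
Qed.

Definition pgen x := pclass (Gen x).

Lemma presented_ind (P : presented -> Prop) :
  (forall x, P (pgen x)) -> P 0 -> (forall x y, P x -> P y -> P (x + y)) ->
  (forall c x, P x -> P (c *: x)) -> (forall o x y, P x -> P y -> P (pop o x y)) ->
  forall x, P x.
Proof.
move=> Pg P0 PD PZ PO x; rewrite -[x]pclassK; elim: (prepr x) => //.
- by move=> s Ps t Pt; rewrite pclass_add; apply: PD.
- by move=> c s Ps; rewrite pclass_scale; apply: PZ.
- by move=> o s Ps t Pt; rewrite pclassO; apply: PO.
Qed.

Section Lift.
Variables (M : lmodType k) (op : O -> M -> M -> M) (f : X -> M).
(* Evaluation at an arbitrary representative: this is the morphism extending f
   as soon as f respects R and the operations of M are bilinear. *)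
Definition lift (x : presented) : M := eval op f (prepr x).

Hypothesis opb : forall o, bilin (op o).
Hypothesis fR : forall s t, R s t -> eval op f s = eval op f t.

Lemma eval_cong s t : cong s t -> eval op f s = eval op f t.
Proof.
elim=> //=; try by [move=> *; congruence].
- by move=> *; rewrite addrA.
- by move=> *; rewrite addrC.
- by move=> *; rewrite add0r.
- by move=> *; rewrite scaleN1r addNr.
- by move=> *; rewrite scalerA.
- by move=> *; rewrite scale1r.
- by move=> *; rewrite scalerDr.
- by move=> *; rewrite scalerDl.
- by move=> *; rewrite (bilDl (opb _)).
- by move=> *; rewrite (bilDr (opb _)).
- by move=> *; rewrite (bilZl (opb _)).
- by move=> *; rewrite (bilZr (opb _)).
Qed.

Lemma lift_class t : lift (pclass t) = eval op f t.
Proof. exact/eval_cong/preprP. Qed.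
Lemma lift_gen x : lift (pgen x) = f x.
Proof. exact: lift_class. Qed.
Lemma lift_linear : linear lift.
Proof.
move=> c x y; rewrite -[x]pclassK -[y]pclassK -pclass_scale -pclass_add.
by rewrite !lift_class.
Qed.
Lemma lift0 : lift 0 = 0. Proof. exact: lift_class. Qed.
Lemma liftD x y : lift (x + y) = lift x + lift y.
Proof. by rewrite -[x in LHS]scale1r lift_linear scale1r. Qed.
Lemma liftZ c x : lift (c *: x) = c *: lift x.
Proof. by rewrite -[c *: x]addr0 lift_linear lift0 addr0. Qed.
Lemma lift_op o x y : lift (pop o x y) = op o (lift x) (lift y).
Proof. by rewrite -[x]pclassK -[y]pclassK -pclassO !lift_class. Qed.
End Lift.

Lemma class_eval t : pclass t = eval pop pgen t.
Proof.
elim: t => //= [s Hs t Ht|c t Ht|o s Hs t Ht].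
- by rewrite pclass_add Hs Ht.
- by rewrite pclass_scale Ht.
- by rewrite pclassO Hs Ht.
Qed.

Definition phomog (D : nmodType) (deg : X -> D) (p : D) (x : presented) :=
  exists2 t, homog deg p t & x = pclass t.

Section Phomog.
Variables (D : nmodType) (deg : X -> D).
Lemma phomog_gen x : phomog deg (deg x) (pgen x).
Proof. by exists (Gen x) => //; constructor. Qed.
Lemma phomog0 p : phomog deg p 0.
Proof. by exists Zero => //; constructor. Qed.
Lemma phomogD p x y : phomog deg p x -> phomog deg p y -> phomog deg p (x + y).
Proof.
move=> [s hs ->] [t ht ->]; exists (Add s t); last by rewrite pclass_add.
by constructor.
Qed.
Lemma phomogZ p c x : phomog deg p x -> phomog deg p (c *: x).
Proof.
move=> [s hs ->]; exists (Scale c s); last by rewrite pclass_scale.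
by constructor.
Qed.
Lemma phomogO p q o x y : phomog deg p x -> phomog deg q y ->
  phomog deg (p + q) (pop o x y).
Proof.
move=> [s hs ->] [t ht ->]; exists (Op o s t); last by rewrite pclassO.
by constructor.
Qed.
Lemma phomog_sum p I (r : seq I) (Q : pred I) (F : I -> presented) :
  (forall i, Q i -> phomog deg p (F i)) ->
  phomog deg p (\sum_(i <- r | Q i) F i).
Proof. by move=> h; apply: big_ind h; [apply: phomog0 | apply: phomogD]. Qed.
End Phomog.
End Terms.

Arguments Zero {k O X}.
Arguments Gen {k O X}.

(* Parity decompositions: {ffun bool -> M} holds the even component (at false)
   and the odd component (at true) of an element of M; smul is the product of
   the Z/2-graded structure. *)
Section Super.
Variables (k : fieldType) (M : lmodType k) (mul : M -> M -> M).

Definition spike (b : bool) (x : M) : {ffun bool -> M} :=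
  [ffun e => if e == b then x else 0].

Definition smul (x y : {ffun bool -> M}) : {ffun bool -> M} :=
  [ffun e => \sum_h mul (x h) (y (h (+) e))].

Lemma spike_linear b : linear (spike b).
Proof.
move=> c x y; apply/ffunP => e; rewrite !ffunE; case: (e == b) => //.
by rewrite scaler0 addr0.
Qed.
Lemma spikeD b x y : spike b (x + y) = spike b x + spike b y.
Proof. by rewrite -[x in LHS]scale1r spike_linear scale1r. Qed.
Lemma spike0 b : spike b 0 = 0.
Proof. by apply/ffunP => e; rewrite !ffunE; case: ifP. Qed.
Lemma spikeZ b c x : spike b (c *: x) = c *: spike b x.
Proof. by rewrite -[c *: x]addr0 spike_linear spike0 addr0. Qed.

Hypothesis mulb : bilin mul.

Lemma smul_bilin : bilin smul.
Proof.
split=> x c y z; apply/ffunP => e; rewrite !ffunE scaler_sumr -big_split /=;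
  apply: eq_bigr => h _; rewrite !ffunE.
  by rewrite (bilDl mulb) (bilZl mulb).
by rewrite (bilDr mulb) (bilZr mulb).
Qed.

Lemma smul_spike a b x y :
  smul (spike a x) (spike b y) = spike (a (+) b) (mul x y).
Proof.
apply/ffunP => e; rewrite !ffunE big_bool /= !ffunE.
case: a; case: b; case: e; rewrite /= !(bil0l mulb, bil0r mulb, add0r, addr0) //.
Qed.

Lemma smulA : associative mul -> associative smul.
Proof.
move=> mA x y z; apply/ffunP => e; rewrite !ffunE !big_bool /= !ffunE !big_bool /=.
rewrite !(bilDl mulb) !(bilDr mulb) !mA.
by case: e => /=; rewrite [X in X + _ = _]addrC addrACA.
Qed.

Lemma smul_sum x y : \sum_e smul x y e = mul (\sum_e x e) (\sum_e y e).
Proof.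
rewrite !big_bool /= !ffunE !big_bool /= !(bilDl mulb) !(bilDr mulb) /=.
by rewrite addrC addrACA; congr (_ + _); rewrite addrC.
Qed.

End Super.

Definition ksign (k : fieldType) (p q : int) : k := (-1) ^ (p * q).

Lemma odd_abszD (p q : int) : odd `|p + q| = odd `|p| (+) odd `|q|.
Proof.
have h (m n : nat) : odd `|m%:Z - n%:Z| = odd m (+) odd n.
  case: (leqP m n) => mn.
    by rewrite -opprB abszN subzn //= oddB // addbC.
  by rewrite subzn 1?ltnW //= oddB // ltnW.
case: p q => [m|m] [n|n].
- by rewrite -PoszD /= oddD.
- by rewrite NegzE abszN h.
- by rewrite NegzE addrC abszN h addbC.
- by rewrite !NegzE -opprD !abszN -PoszD absz_nat oddD.
Qed.

Lemma ksignE (k : fieldType) p q : ksign k p q = (-1) ^+ (odd `|p| && odd `|q|).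
Proof.
have h (m : int) : (-1 : k) ^ m = (-1) ^+ odd `|m|.
  case: m => n; first by rewrite signr_odd.
  by rewrite NegzE -exprnN -exprVn invrN1 -[LHS]signr_odd abszN absz_nat.
by rewrite /ksign h abszM oddM.
Qed.

(* ga i and gb i stand for the generators a_(i+1) and b_(i+1) *)
Inductive lie_gen := gd | ga of nat | gb of nat.

Definition lie_gen_deg (g : lie_gen) : int :=
  match g with gd | ga _ => -1 | gb _ => 0 end.
Definition lie_gen_wt (g : lie_gen) : nat :=
  match g with gd => 0%N | ga i | gb i => i.+1 end.

Section Lie.
Variable k : fieldType.

Local Notation lterm := (term k unit lie_gen) (only parsing).
Definition td : lterm := Gen gd.
Definition ta (n : nat) : lterm := Gen (ga n.-1).
Definition tb (n : nat) : lterm := Gen (gb n.-1).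
Definition tbr (s t : lterm) : lterm := Op tt s t.

(* Graded antisymmetry and graded Jacobi identity; in characteristic zero they
   imply [x, x] = 0 for x even and [x, [x, x]] = 0 for x odd. *)
Inductive lie_rel : lterm -> lterm -> Prop :=
| lie_anticomm p q s t :
    homog lie_gen_deg p s -> homog lie_gen_deg q t ->
    lie_rel (tbr s t) (Scale (- ksign k p q) (tbr t s))
| lie_jacobi p q r s t u :
    homog lie_gen_deg p s -> homog lie_gen_deg q t -> homog lie_gen_deg r u ->
    lie_rel (tbr s (tbr t u))
            (Add (tbr (tbr s t) u) (Scale (ksign k p q) (tbr t (tbr s u))))
| lie_defining n : (0 < n)%N ->
    lie_rel (tbr (tb n) td)
            (Add (ta n) (Scale (-1) (\big[@Add _ _ _/Zero]_(1 <= i < n)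
               Scale (i%:R / n%:R) (tbr (tb i) (ta (n - i)))))).

Definition lie := presented lie_rel.
HB.instance Definition _ := GRing.Lmodule.on lie.

Definition lbr (x y : lie) : lie := pop tt x y.
Definition ldeg (p : int) (x : lie) := phomog lie_gen_deg p x.
Definition lwt (n : nat) (x : lie) := phomog lie_gen_wt n x.
Definition ld : lie := pgen _ gd.
Definition la (n : nat) : lie := pgen _ (ga n.-1).
Definition lb (n : nat) : lie := pgen _ (gb n.-1).

Lemma lbr_bilin : bilin lbr.
Proof. exact: pop_bilin. Qed.

Lemma lbr_anticomm p q x y : ldeg p x -> ldeg q y ->
  lbr x y = - ksign k p q *: lbr y x.
Proof.
move=> [s hs ->] [t ht ->]; rewrite /lbr -!pclassO -pclass_scale.
by apply/pclassP/cong_rel; apply: lie_anticomm.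
Qed.

Lemma lbr_jacobi p q r x y z : ldeg p x -> ldeg q y -> ldeg r z ->
  lbr x (lbr y z) = lbr (lbr x y) z + ksign k p q *: lbr y (lbr x z).
Proof.
move=> [s hs ->] [t ht ->] [u hu ->].
rewrite /lbr -!pclassO -pclass_scale -pclass_add.
by apply/pclassP/cong_rel; apply: lie_jacobi hu.
Qed.

Lemma lbr_defining n : (0 < n)%N ->
  lbr (lb n) ld =
  la n - \sum_(1 <= i < n) (i%:R / n%:R) *: lbr (lb i) (la (n - i)).
Proof.
move=> n0; rewrite /lbr -!pclassO.
have -> : \sum_(1 <= i < n) i%:R / n%:R *: pop tt (lb i) (la (n - i)) =
  pclass lie_rel (\big[@Add _ _ _/Zero]_(1 <= i < n)
    Scale (i%:R / n%:R) (tbr (tb i) (ta (n - i)))).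
  elim/big_rec2: _ => [//|i x y _ ->].
  by rewrite pclass_add pclass_scale pclassO.
rewrite -scaleN1r -pclass_scale -[la n]/(pclass _ _) -pclass_add.
exact/pclassP/cong_rel/lie_defining.
Qed.

Lemma lie_rel_homog s t : lie_rel s t ->
  exists p, homog lie_gen_deg p s /\ homog lie_gen_deg p t.
Proof.
have hO p q r s' t' : homog lie_gen_deg p s' -> homog lie_gen_deg q t' ->
    p + q = r -> homog lie_gen_deg r (tbr s' t').
  by move=> hs ht <-; constructor.
have hg g : homog lie_gen_deg (lie_gen_deg g) (Gen g : lterm) by constructor.
case=> [p q {}s {}t hs ht|p q r {}s {}t u hs ht hu|n n0].
- exists (p + q); split; first exact: hO hs ht _.
  by constructor; apply: (hO _ _ _ _ _ ht hs); rewrite addrC.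
- exists (p + (q + r)); split; first exact: hO hs (hO _ _ _ _ _ ht hu _) _.
  constructor.
    by apply: (hO _ _ _ _ _ (hO _ _ _ _ _ hs ht erefl) hu); rewrite addrA.
  constructor; apply: (hO _ _ _ _ _ ht (hO _ _ _ _ _ hs hu erefl)).
  by rewrite addrCA.
- exists (-1); split.
    by apply: (hO _ _ _ _ _ (hg (gb n.-1)) (hg gd)).
  constructor; first exact: (hg (ga n.-1)).
  constructor; elim/big_rec: _ => [|i x _ hx]; first by constructor.
  constructor=> //; constructor.
  by apply: (hO _ _ _ _ _ (hg (gb _)) (hg (ga _))).
Qed.

Let lsmul (_ : unit) := smul lbr.
Let lspike g : {ffun bool -> lie} := spike (odd `|lie_gen_deg g|%N) (pgen _ g).

Definition lie_parts : lie -> {ffun bool -> lie} := lift lsmul lspike.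

Let lsmul_bilin o : bilin (lsmul o).
Proof. exact/smul_bilin/lbr_bilin. Qed.

Let eval_homog p t : homog lie_gen_deg p t ->
  eval lsmul lspike t = spike (odd `|p|%N) (pclass lie_rel t).
Proof.
elim=> //= [q|q s u _ -> _ ->|q c u _ ->|q r o s u _ -> _ ->].
- by rewrite [pclass _ _]pclass0 spike0.
- by rewrite pclass_add spikeD.
- by rewrite pclass_scale spikeZ.
- rewrite pclassO odd_abszD /lsmul; case: o.
  by rewrite smul_spike //; apply: lbr_bilin.
Qed.

Let lparts_rel s t : lie_rel s t -> eval lsmul lspike s = eval lsmul lspike t.
Proof.
move=> st; have [p [hs ht]] := lie_rel_homog st.
rewrite (eval_homog hs) (eval_homog ht); by congr spike; apply/pclassP/cong_rel.
Qed.

Lemma lie_parts_linear : linear lie_parts.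
Proof. exact: lift_linear lsmul_bilin lparts_rel. Qed.

Lemma lie_parts_homog p x : ldeg p x -> lie_parts x = spike (odd `|p|%N) x.
Proof.
by move=> [t ht ->]; rewrite /lie_parts (lift_class lsmul_bilin lparts_rel) (eval_homog ht).
Qed.

Lemma lie_parts_br x y :
  lie_parts (lbr x y) = smul lbr (lie_parts x) (lie_parts y).
Proof. exact: (lift_op lsmul_bilin lparts_rel). Qed.

Lemma lie_parts_gen g : lie_parts (pgen _ g) = lspike g.
Proof. exact: (lift_gen lsmul_bilin lparts_rel). Qed.

Lemma lie_partsD x y : lie_parts (x + y) = lie_parts x + lie_parts y.
Proof. by rewrite -[x in LHS]scale1r lie_parts_linear scale1r. Qed.
Lemma lie_parts0 : lie_parts 0 = 0.
Proof. exact: (lift0 lsmul_bilin lparts_rel). Qed.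
Lemma lie_partsZ c x : lie_parts (c *: x) = c *: lie_parts x.
Proof. exact: (liftZ lsmul_bilin lparts_rel). Qed.

Lemma lie_parts_sum x : \sum_e lie_parts x e = x.
Proof.
elim/presented_ind: x => [g||x y hx hy|c x hx|[] x y hx hy].
- by rewrite lie_parts_gen big_bool !ffunE; case: odd; rewrite /= ?add0r ?addr0.
- by rewrite lie_parts0 big_bool !ffunE /= addr0.
- rewrite -[in RHS]hx -[in RHS]hy lie_partsD -big_split /=.
  by apply: eq_bigr => e _; rewrite ffunE.
- rewrite -[in RHS]hx lie_partsZ scaler_sumr.
  by apply: eq_bigr => e _; rewrite ffunE.
- rewrite -[in RHS]hx -[in RHS]hy -[pop _ _ _]/(lbr _ _) lie_parts_br.
  exact/smul_sum/lbr_bilin.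
Qed.

Lemma lie_parts_idem x e : lie_parts (lie_parts x e) = spike e (lie_parts x e).
Proof.
elim/presented_ind: x e => [g||x y hx hy|c x hx|[] x y hx hy] e.
- rewrite lie_parts_gen ffunE; case: eqP => [->|_]; first exact: lie_parts_gen.
  by rewrite lie_parts0 spike0.
- by rewrite lie_parts0 ffunE lie_parts0 spike0.
- by rewrite lie_partsD ffunE lie_partsD hx hy spikeD.
- by rewrite lie_partsZ ffunE lie_partsZ hx spikeZ.
- rewrite -[pop _ _ _]/(lbr _ _) lie_parts_br ffunE.
  rewrite big_bool /= lie_partsD !lie_parts_br !hx !hy !(smul_spike lbr_bilin).
  by case: e; rewrite -spikeD.
Qed.

Lemma lie_parts_wt n x e : lwt n x -> lwt n (lie_parts x e).
Proof.
move=> [t ht ->]; elim: ht e => {n t} [g|n|n s t _ hs _ ht|n c t _ ht|m n [] s t _ hs _ ht] e.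
- rewrite [pclass _ _]/(pgen _ _) lie_parts_gen ffunE; case: ifP => _.
    exact: phomog_gen.
  exact: phomog0.
- by rewrite [pclass _ _]pclass0 lie_parts0 ffunE; apply: phomog0.
- by rewrite pclass_add lie_partsD ffunE; apply: phomogD; [apply: hs|apply: ht].
- by rewrite pclass_scale lie_partsZ ffunE; apply: phomogZ; apply: ht.
- rewrite pclassO lie_parts_br ffunE.
  by apply: phomog_sum => h _; apply: phomogO; [apply: hs|apply: ht].
Qed.
End Lie.

Inductive env_gen (k : fieldType) := EOne | EInj of lie k.
Arguments EOne {k}.

Section Envelope.
Variable k : fieldType.

Let eterm := term k unit (env_gen k).
Let tinj x : eterm := Gen (EInj x).
Let tone : eterm := Gen EOne.
Let tmul (s t : eterm) : eterm := Op tt s t.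

Inductive env_rel : eterm -> eterm -> Prop :=
| env_mulA s t u : env_rel (tmul s (tmul t u)) (tmul (tmul s t) u)
| env_mul1 s : env_rel (tmul tone s) s
| env_1mul s : env_rel (tmul s tone) s
| env_inj_linear c x y :
    env_rel (tinj (c *: x + y)) (Add (Scale c (tinj x)) (tinj y))
| env_inj_br p q x y : ldeg p x -> ldeg q y ->
    env_rel (tinj (lbr x y))
      (Add (tmul (tinj x) (tinj y)) (Scale (- ksign k p q) (tmul (tinj y) (tinj x)))).

Definition uenv := presented env_rel.
HB.instance Definition _ := GRing.Lmodule.on uenv.

Definition emul (x y : uenv) : uenv := pop tt x y.
Definition eone : uenv := pgen _ EOne.
Definition inj (x : lie k) : uenv := pgen _ (EInj x).

Lemma emul_bilin : bilin emul.
Proof. exact: pop_bilin. Qed.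

Lemma emulA : associative emul.
Proof.
move=> x y z; rewrite /emul -[x]pclassK -[y]pclassK -[z]pclassK -!pclassO.
exact/pclassP/cong_rel/env_mulA.
Qed.
Lemma emul1 : left_id eone emul.
Proof.
move=> x; rewrite /emul -[x]pclassK -[eone]/(pclass _ tone) -!pclassO.
exact/pclassP/cong_rel/env_mul1.
Qed.
Lemma e1mul : right_id eone emul.
Proof.
move=> x; rewrite /emul -[x]pclassK -[eone]/(pclass _ tone) -!pclassO.
exact/pclassP/cong_rel/env_1mul.
Qed.
Lemma emulDl : left_distributive emul +%R.
Proof. by move=> x y z; apply: (bilDl emul_bilin). Qed.
Lemma emulDr : right_distributive emul +%R.
Proof. by move=> x y z; apply: (bilDr emul_bilin). Qed.

Let cmul (_ : unit) (x y : k^o) : k^o := x * y.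
Let cgen (g : env_gen k) : k^o := if g is EOne then 1 else 0.

Definition counit : uenv -> k^o := lift cmul cgen.

Let cmul_bilin o : bilin (cmul o).
Proof.
split=> x c y z; rewrite /cmul; first by rewrite mulrDl scalerAl.
by rewrite mulrDr scalerAr.
Qed.
Let cgen_rel s t : env_rel s t -> eval cmul cgen s = eval cmul cgen t.
Proof.
case=> {s t} //=.
- by move=> s t u; rewrite /cmul mulrA.
- by move=> s; rewrite /cmul mul1r.
- by move=> s; rewrite /cmul mulr1.
- by move=> c x y; rewrite scaler0 addr0.
- by move=> p q x y _ _; rewrite /cmul mul0r scaler0 addr0.
Qed.

Lemma counit1 : counit eone = 1.
Proof. exact: (lift_gen cmul_bilin cgen_rel). Qed.
Lemma counit_inj x : counit (inj x) = 0.
Proof. exact: (lift_gen cmul_bilin cgen_rel). Qed.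
Lemma counit_linear : linear counit.
Proof. exact: lift_linear cmul_bilin cgen_rel. Qed.
Lemma counit0 : counit 0 = 0.
Proof. exact: lift0 cmul_bilin cgen_rel. Qed.
Lemma counitM x y : counit (emul x y) = counit x * counit y.
Proof. exact: (lift_op cmul_bilin cgen_rel). Qed.

Lemma eone_neq0 : eone != 0.
Proof.
apply/eqP => /(congr1 counit); rewrite counit1 counit0 => /eqP.
by rewrite oner_eq0.
Qed.

HB.instance Definition _ := GRing.Zmodule_isNzRing.Build uenv
  emulA emul1 e1mul emulDl emulDr eone_neq0.

Lemma env_scaleAl (c : k) (x y : uenv) : c *: (x * y) = c *: x * y.
Proof. by rewrite [RHS](bilZl emul_bilin). Qed.
HB.instance Definition _ := GRing.Lmodule_isLalgebra.Build k uenv env_scaleAl.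
Lemma env_scaleAr (c : k) (x y : uenv) : c *: (x * y) = x * (c *: y).
Proof. by rewrite [RHS](bilZr emul_bilin). Qed.
HB.instance Definition _ := GRing.Lalgebra_isAlgebra.Build k uenv env_scaleAr.

Lemma inj_linear : linear inj.
Proof.
move=> c x y; rewrite /inj /pgen -pclass_scale -pclass_add.
exact/pclassP/cong_rel/env_inj_linear.
Qed.
HB.instance Definition _ := GRing.isLinear.Build k (lie k) uenv _ inj inj_linear.

Lemma inj_br p q x y : ldeg p x -> ldeg q y ->
  inj (lbr x y) = inj x * inj y - ksign k p q *: (inj y * inj x).
Proof.
move=> hx hy; rewrite -scaleNr -[_ * _ in X in X + _]/(pop tt _ _).
rewrite -[_ * _]/(pop tt _ _) /inj /pgen -!pclassO -pclass_scale -pclass_add.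
exact/pclassP/cong_rel/env_inj_br.
Qed.

Section EnvLift.
Variables (A : algType k) (f : lie k -> A).
Definition env_lift : uenv -> A :=
  lift (fun _ => *%R) (fun g => if g is EInj x then f x else 1).
Hypothesis f_linear : linear f.
Hypothesis f_br : forall p q x y, ldeg p x -> ldeg q y ->
  f (lbr x y) = f x * f y - ksign k p q *: (f y * f x).

Let opb (o : unit) : bilin (fun x y : A => x * y).
Proof.
split=> x c y z; first by rewrite mulrDl scalerAl.
by rewrite mulrDr scalerAr.
Qed.
Let frel s t : env_rel s t ->
  eval (fun _ => *%R) (fun g => if g is EInj x then f x else 1) s =
  eval (fun _ => *%R) (fun g => if g is EInj x then f x else 1) t.
Proof.
case=> {s t} //=.
- by move=> s t u; rewrite mulrA.
- by move=> s; rewrite mul1r.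
- by move=> s; rewrite mulr1.
- by move=> p q x y hx hy; rewrite (f_br hx hy) scaleNr.
Qed.

Lemma env_lift_inj x : env_lift (inj x) = f x.
Proof. exact: (lift_gen opb frel). Qed.
Lemma env_lift1 : env_lift 1 = 1.
Proof. exact: (lift_gen opb frel). Qed.
Lemma env_liftM x y : env_lift (x * y) = env_lift x * env_lift y.
Proof. exact: (lift_op opb frel). Qed.
Lemma env_lift_linear : linear env_lift.
Proof. exact: lift_linear opb frel. Qed.
End EnvLift.

Lemma env_ind (P : uenv -> Prop) :
  P 1 -> (forall x, P (inj x)) -> P 0 ->
  (forall x y, P x -> P y -> P (x + y)) ->
  (forall c x, P x -> P (c *: x)) -> (forall x y, P x -> P y -> P (x * y)) ->
  forall x, P x.
Proof.
by move=> P1 Pi P0 PD PZ PM x; elim/presented_ind: x => // [[]|[]].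
Qed.

(* The weight components: the least family of subspaces containing 1 in weight
   0 and the components of the Lie algebra, and compatible with the product. *)
Inductive ewt : nat -> uenv -> Prop :=
| ewt0 n : ewt n 0
| ewtD n x y : ewt n x -> ewt n y -> ewt n (x + y)
| ewtZ n c x : ewt n x -> ewt n (c *: x)
| ewt1 : ewt 0 1
| ewt_inj n x : lwt n x -> ewt n (inj x)
| ewtM m n x y : ewt m x -> ewt n y -> ewt (m + n) (x * y).

Let esmul (_ : unit) := smul emul.
Let egen (g : env_gen k) : {ffun bool -> uenv} :=
  if g is EInj x then [ffun e => inj (lie_parts x e)] else spike false 1.

Definition env_parts : uenv -> {ffun bool -> uenv} := lift esmul egen.

Let esmul_bilin o : bilin (esmul o).
Proof. exact/smul_bilin/emul_bilin. Qed.

Lemma spike_inj p x : ldeg p x ->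
  [ffun e => inj (lie_parts x e)] = spike (odd `|p|%N) (inj x).
Proof.
move=> hx; apply/ffunP => e; rewrite (lie_parts_homog hx) !ffunE.
by case: ifP => //; rewrite linear0.
Qed.

Let egen_rel s t : env_rel s t -> eval esmul egen s = eval esmul egen t.
Proof.
case=> {s t} [s t u|s|s|c x y|p q x y hx hy] /=.
- exact/smulA/emulA/emul_bilin.
- apply/ffunP => e; rewrite ffunE big_bool /= !ffunE /= (bil0l emul_bilin) add0r.
  exact: mul1r.
- apply/ffunP => e; rewrite ffunE big_bool /= !ffunE.
  by case: e; rewrite /= (bil0r emul_bilin) ?add0r ?addr0; apply: mulr1.
- by apply/ffunP => e; rewrite !ffunE lie_partsD lie_partsZ !ffunE linearP.
- rewrite (spike_inj hx) (spike_inj hy) (spike_inj (phomogO tt hx hy)).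
  rewrite /esmul !(smul_spike emul_bilin) odd_abszD [in X in _ + X]addbC.
  by rewrite -spikeZ -spikeD (inj_br hx hy) scaleNr.
Qed.

Lemma env_parts_linear : linear env_parts.
Proof. exact: lift_linear esmul_bilin egen_rel. Qed.
Lemma env_partsD x y : env_parts (x + y) = env_parts x + env_parts y.
Proof. exact: (liftD esmul_bilin egen_rel). Qed.
Lemma env_partsZ c x : env_parts (c *: x) = c *: env_parts x.
Proof. exact: (liftZ esmul_bilin egen_rel). Qed.
Lemma env_parts0 : env_parts 0 = 0.
Proof. exact: lift0 esmul_bilin egen_rel. Qed.
Lemma env_parts1 : env_parts 1 = spike false 1.
Proof. exact: (lift_gen esmul_bilin egen_rel). Qed.
Lemma env_parts_inj x : env_parts (inj x) = [ffun e => inj (lie_parts x e)].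
Proof. exact: (lift_gen esmul_bilin egen_rel). Qed.
Lemma env_parts_inj_homog p x :
  ldeg p x -> env_parts (inj x) = spike (odd `|p|%N) (inj x).
Proof. by move=> hx; rewrite env_parts_inj (spike_inj hx). Qed.
Lemma env_partsM x y : env_parts (x * y) = smul *%R (env_parts x) (env_parts y).
Proof. exact: (lift_op esmul_bilin egen_rel). Qed.

Lemma env_parts_sum x : \sum_e env_parts x e = x.
Proof.
elim/env_ind: x => [|x||x y hx hy|c x hx|x y hx hy].
- by rewrite env_parts1 big_bool !ffunE /= add0r.
- rewrite env_parts_inj -[in RHS](lie_parts_sum x) linear_sum.
  by apply: eq_bigr => e _; rewrite ffunE.
- by rewrite env_parts0 big_bool !ffunE /= addr0.
- rewrite -[in RHS]hx -[in RHS]hy env_partsD -big_split /=.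
  by apply: eq_bigr => e _; rewrite ffunE.
- rewrite -[in RHS]hx env_partsZ scaler_sumr.
  by apply: eq_bigr => e _; rewrite ffunE.
- rewrite -[in RHS]hx -[in RHS]hy env_partsM.
  exact/smul_sum/emul_bilin.
Qed.

Lemma counit_wt n x : (0 < n)%N -> ewt n x -> counit x = 0.
Proof.
move=> n0 hx; elim: hx n0 => {n x} [n|n x y _ hx _ hy|n c x _ hx||n x _|m n x y _ hx _ hy] n0 //.
- exact: counit0.
- by rewrite -[x]scale1r counit_linear hx // hy // scaler0 addr0.
- by rewrite -[c *: x]addr0 counit_linear hx // counit0 scaler0 addr0.
- exact: counit_inj.
- rewrite [LHS]counitM; case: m hx n0 => [_|m hx _]; last by rewrite hx ?mul0r.
  by rewrite add0n => n0; rewrite hy ?mulr0.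
Qed.

Lemma env_parts_wt n x e : ewt n x -> ewt n (env_parts x e).
Proof.
move=> h; elim: h e => {n x} [n|n x y _ hx _ hy|n c x _ hx||n x hx|m n x y _ hx _ hy] e.
- by rewrite env_parts0 ffunE; apply: ewt0.
- by rewrite env_partsD ffunE; apply: ewtD.
- by rewrite env_partsZ ffunE; apply: ewtZ.
- by rewrite env_parts1 ffunE; case: ifP => _; [apply: ewt1|apply: ewt0].
- by rewrite env_parts_inj ffunE; apply/ewt_inj/lie_parts_wt.
- rewrite env_partsM ffunE; apply: big_ind; [exact: ewt0|exact: ewtD|].
  by move=> h _; apply: ewtM.
Qed.

Definition has_parity (e : bool) (x : uenv) := env_parts x = spike e x.

Lemma parity1 : has_parity false 1.
Proof. exact: env_parts1. Qed.
Lemma parity_inj p x : ldeg p x -> has_parity (odd `|p|%N) (inj x).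
Proof. exact: env_parts_inj_homog. Qed.
Lemma parityM e f x y :
  has_parity e x -> has_parity f y -> has_parity (e (+) f) (x * y).
Proof.
by move=> hx hy; rewrite /has_parity env_partsM hx hy (smul_spike emul_bilin).
Qed.

Lemma parity_parts e x : has_parity e (env_parts x e).
Proof.
rewrite /has_parity; elim/env_ind: x e => [|x||x y hx hy|c x hx|x y hx hy] e.
- rewrite env_parts1 ffunE; case: eqP => [->|_]; first exact: env_parts1.
  by rewrite env_parts0 spike0.
- rewrite env_parts_inj ffunE env_parts_inj; apply/ffunP => f; rewrite !ffunE.
  by rewrite lie_parts_idem ffunE; case: ifP => // _; rewrite linear0.
- by rewrite env_parts0 ffunE env_parts0 spike0.
- by rewrite env_partsD ffunE env_partsD hx hy spikeD.
- by rewrite env_partsZ ffunE env_partsZ hx spikeZ.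
- rewrite env_partsM ffunE; apply/ffunP => f.
  rewrite big_bool /= env_partsD !env_partsM !hx !hy !(smul_spike emul_bilin).
  by case: e; rewrite -spikeD.
Qed.

End Envelope.

Section Tensor.
Variable k : fieldType.
Local Notation U := (uenv k).

Let xterm := term k void (U * U)%type.
Let pure (u v : U) : xterm := Gen (u, v).

Inductive tens_rel : xterm -> xterm -> Prop :=
| tens_linl c u u' v :
    tens_rel (pure (c *: u + u') v) (Add (Scale c (pure u v)) (pure u' v))
| tens_linr c u v v' :
    tens_rel (pure u (c *: v + v')) (Add (Scale c (pure u v)) (pure u v')).

Definition uenv2 := presented tens_rel.
HB.instance Definition _ := GRing.Lmodule.on uenv2.

Definition tens (u v : U) : uenv2 := pgen _ (u, v).

Lemma tens_bilin : bilin tens.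
Proof.
split=> [v c u u' | u c v v']; rewrite /tens /pgen -pclass_scale -pclass_add.
  exact/pclassP/cong_rel/tens_linl.
exact/pclassP/cong_rel/tens_linr.
Qed.

Lemma tens_ind (P : uenv2 -> Prop) :
  (forall u v, P (tens u v)) -> P 0 ->
  (forall x y, P x -> P y -> P (x + y)) -> (forall c x, P x -> P (c *: x)) ->
  forall x, P x.
Proof. by move=> Pt P0 PD PZ x; elim/presented_ind: x => // [[]]. Qed.

Section TensLift.
Variables (M : lmodType k) (f : U -> U -> M).
Definition noop (o : void) (x y : M) : M := match o with end.
Definition tens_lift : uenv2 -> M := lift noop (fun p => f p.1 p.2).
Hypothesis fb : bilin f.

Let noop_bilin o : bilin (noop o). Proof. by case: o. Qed.
Let frel s t : tens_rel s t ->
  eval noop (fun p => f p.1 p.2) s = eval noop (fun p => f p.1 p.2) t.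
Proof.
by case=> [c u u' v|c u v v'] /=; rewrite ?(bilDl fb, bilDr fb, bilZl fb, bilZr fb).
Qed.

Lemma tens_liftE u v : tens_lift (tens u v) = f u v.
Proof. exact: (lift_gen noop_bilin frel). Qed.
Lemma tens_lift_linear : linear tens_lift.
Proof. exact: lift_linear noop_bilin frel. Qed.
Lemma tens_lift0 : tens_lift 0 = 0.
Proof. exact: lift0 noop_bilin frel. Qed.
Lemma tens_liftD x y : tens_lift (x + y) = tens_lift x + tens_lift y.
Proof. exact: (liftD noop_bilin frel). Qed.
Lemma tens_liftZ c x : tens_lift (c *: x) = c *: tens_lift x.
Proof. exact: (liftZ noop_bilin frel). Qed.
End TensLift.

(* (a (x) b)(c (x) d) = (-1)^(|b||c|) ac (x) bd for b, c homogeneous, see tensM *)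
Definition koszul (a b c d : U) : uenv2 :=
  \sum_e \sum_f (-1) ^+ (e && f) *: tens (a * env_parts c f) (env_parts b e * d).

Definition tens_mul (x y : uenv2) : uenv2 :=
  tens_lift (fun a b => tens_lift (koszul a b) y) x.

Lemma koszul_bilinr a b : bilin (koszul a b).
Proof.
split=> z c x y; rewrite /koszul scaler_sumr -big_split; apply: eq_bigr => e _;
  rewrite scaler_sumr -big_split; apply: eq_bigr => f _ /=;
  rewrite scalerA mulrC -scalerA -scalerDr; congr (_ *: _).
  by rewrite env_partsD env_partsZ !ffunE -tens_bilin.1 mulrDr -scalerAr.
by rewrite -tens_bilin.2 mulrDr -scalerAr.
Qed.

Lemma koszul_bilinl c d : bilin (fun a b => koszul a b c d).
Proof.
split=> z r x y; rewrite /koszul scaler_sumr -big_split; apply: eq_bigr => e _;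
  rewrite scaler_sumr -big_split; apply: eq_bigr => f _ /=;
  rewrite scalerA mulrC -scalerA -scalerDr; congr (_ *: _).
  by rewrite -tens_bilin.1 mulrDl -scalerAl.
by rewrite env_partsD env_partsZ !ffunE -tens_bilin.2 mulrDl -scalerAl.
Qed.

Lemma koszul_lift_bilin y : bilin (fun a b => tens_lift (koszul a b) y).
Proof.
have h a b := koszul_bilinr a b.
split=> z r a b; elim/tens_ind: y => [u v||y y' hy hy'|c y hy].
- by rewrite !tens_liftE // (koszul_bilinl u v).1.
- by rewrite !tens_lift0 // scaler0 addr0.
- by rewrite !tens_liftD // hy hy' scalerDr addrACA.
- by rewrite !tens_liftZ // hy scalerDr !scalerA mulrC.
- by rewrite !tens_liftE // (koszul_bilinl u v).2.
- by rewrite !tens_lift0 // scaler0 addr0.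
- by rewrite !tens_liftD // hy hy' scalerDr addrACA.
- by rewrite !tens_liftZ // hy scalerDr !scalerA mulrC.
Qed.

Lemma tens_mul_bilin : bilin tens_mul.
Proof.
split=> [y|x]; first exact/tens_lift_linear/koszul_lift_bilin.
move=> c y y'; rewrite /tens_mul; elim/tens_ind: x => [u v||x x' hx hx'|r x hx].
- rewrite !tens_liftE; try exact: koszul_lift_bilin.
  exact/tens_lift_linear/koszul_bilinr.
- by rewrite !tens_lift0 ?scaler0 ?addr0 //; apply: koszul_lift_bilin.
- rewrite !tens_liftD ?hx ?hx' ?scalerDr; try exact: koszul_lift_bilin.
  by rewrite addrACA.
- rewrite !tens_liftZ ?hx ?scalerDr; try exact: koszul_lift_bilin.
  by rewrite !scalerA mulrC.
Qed.

Lemma tens_mulE a b c d : tens_mul (tens a b) (tens c d) = koszul a b c d.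
Proof.
by rewrite /tens_mul !tens_liftE //; [apply: koszul_bilinr|apply: koszul_lift_bilin].
Qed.

Lemma tens_mul_parity e f a b c d : has_parity e b -> has_parity f c ->
  tens_mul (tens a b) (tens c d) = (-1) ^+ (e && f) *: tens (a * c) (b * d).
Proof.
rewrite tens_mulE /koszul => -> ->.
rewrite (bigD1 e) //= (bigD1 f) //= !ffunE !eqxx.
rewrite big1 ?addr0 => [|g /negPf gf]; last first.
  by rewrite ffunE gf mulr0 (bil0l tens_bilin) scaler0.
rewrite big1 ?addr0 // => g /negPf ge; rewrite big1 // => h _.
by rewrite !ffunE ge mul0r (bil0r tens_bilin) scaler0.
Qed.

Lemma env_parity_ind (P : uenv2 -> Prop) :
  (forall e f u v, has_parity e u -> has_parity f v -> P (tens u v)) -> P 0 ->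
  (forall x y, P x -> P y -> P (x + y)) -> (forall c x, P x -> P (c *: x)) ->
  forall x, P x.
Proof.
move=> Pt P0 PD PZ; apply: tens_ind => // u v.
rewrite -[u]env_parts_sum -[v]env_parts_sum (bil_suml tens_bilin).
apply: big_ind => // e _; rewrite (bil_sumr tens_bilin); apply: big_ind => // f _.
by apply: Pt; apply: parity_parts.
Qed.

Local Notation tbD := (bilDl tens_mul_bilin, bilDr tens_mul_bilin).
Local Notation tbZ := (bilZl tens_mul_bilin, bilZr tens_mul_bilin).
Local Notation tb0 := (bil0l tens_mul_bilin, bil0r tens_mul_bilin).

Lemma tens_mulA : associative tens_mul.
Proof.
move=> x y z.
elim/env_parity_ind: x => [e f a b ha hb||x x' hx hx'|r x hx]; first last.
- by rewrite !tbZ hx.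
- by rewrite !tbD hx hx'.
- by rewrite !tb0.
elim/env_parity_ind: y => [g h c d hc hd||y y' hy hy'|r y hy]; first last.
- by rewrite !tbZ hy.
- by rewrite !tbD hy hy'.
- by rewrite !tb0.
elim/env_parity_ind: z => [i j u v hu hv||z z' hz hz'|r z hz]; first last.
- by rewrite !tbZ hz.
- by rewrite !tbD hz hz'.
- by rewrite !tb0.
rewrite (tens_mul_parity _ _ hd hu) (tens_mul_parity _ _ hb hc) !tbZ.
rewrite (tens_mul_parity _ _ hb (parityM hc hu)) (tens_mul_parity _ _ (parityM hb hd) hu).
rewrite !scalerA !mulrA; congr (_ *: _).
rewrite -!signr_addb; congr (_ ^+ _).
by clear; case: f; case: g; case: h; case: i.
Qed.

Definition tens_one := tens 1 1.

Lemma tens_mul1 : left_id tens_one tens_mul.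
Proof.
move=> x; elim/env_parity_ind: x => [e f a b ha hb||x x' hx hx'|r x hx].
- by rewrite (tens_mul_parity _ _ (parity1 k) ha) /= expr0 scale1r !mul1r.
- by rewrite !tb0.
- by rewrite !tbD hx hx'.
- by rewrite !tbZ hx.
Qed.
Lemma tens_1mul : right_id tens_one tens_mul.
Proof.
move=> x; elim/env_parity_ind: x => [e f a b ha hb||x x' hx hx'|r x hx].
- by rewrite (tens_mul_parity _ _ hb (parity1 k)) andbF expr0 scale1r !mulr1.
- by rewrite !tb0.
- by rewrite !tbD hx hx'.
- by rewrite !tbZ hx.
Qed.
Lemma tens_mulDl : left_distributive tens_mul +%R.
Proof. by move=> x y z; apply: (bilDl tens_mul_bilin). Qed.
Lemma tens_mulDr : right_distributive tens_mul +%R.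
Proof. by move=> x y z; apply: (bilDr tens_mul_bilin). Qed.

Lemma tens_one_neq0 : tens_one != 0.
Proof.
have hb : bilin (fun u v : U => (counit u * counit v : k^o)).
  split=> x c y z; first by rewrite counit_linear mulrDl scalerAl.
  by rewrite counit_linear mulrDr scalerAr.
apply/eqP => /(congr1 (tens_lift (fun u v => (counit u * counit v : k^o)))).
rewrite tens_lift0 // tens_liftE // counit1 mulr1 => /eqP.
by rewrite oner_eq0.
Qed.

HB.instance Definition _ := GRing.Zmodule_isNzRing.Build uenv2
  tens_mulA tens_mul1 tens_1mul tens_mulDl tens_mulDr tens_one_neq0.

Lemma tens_scaleAl (c : k) (x y : uenv2) : c *: (x * y) = c *: x * y.
Proof. by rewrite [RHS](bilZl tens_mul_bilin). Qed.
HB.instance Definition _ := GRing.Lmodule_isLalgebra.Build k uenv2 tens_scaleAl.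
Lemma tens_scaleAr (c : k) (x y : uenv2) : c *: (x * y) = x * (c *: y).
Proof. by rewrite [RHS](bilZr tens_mul_bilin). Qed.
HB.instance Definition _ := GRing.Lalgebra_isAlgebra.Build k uenv2 tens_scaleAr.

Lemma tensM e f a b c d : has_parity e b -> has_parity f c ->
  tens a b * tens c d = (-1) ^+ (e && f) *: tens (a * c) (b * d).
Proof. exact: tens_mul_parity. Qed.

Inductive twt : nat -> uenv2 -> Prop :=
| twt0 n : twt n 0
| twtD n x y : twt n x -> twt n y -> twt n (x + y)
| twtZ n c x : twt n x -> twt n (c *: x)
| twt_tens m n u v : ewt m u -> ewt n v -> twt (m + n) (tens u v).

Lemma twt1 : twt 0 1.
Proof. exact: (twt_tens (ewt1 k) (ewt1 k)). Qed.

Lemma twtM m n x y : twt m x -> twt n y -> twt (m + n) (x * y).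
Proof.
move=> hx hy; elim: hx => {m x} [m|m x x' _ hx _ hx'|m c x _ hx|m m' a b ha hb].
- by rewrite mul0r; apply: twt0.
- by rewrite mulrDl; apply: twtD.
- by rewrite -scalerAl; apply: twtZ.
elim: hy => {n y} [n|n y y' _ hy _ hy'|n c y _ hy|n n' c d hc hd].
- by rewrite mulr0; apply: twt0.
- by rewrite mulrDr; apply: twtD.
- by rewrite -scalerAr; apply: twtZ.
rewrite [_ * _]tens_mulE /koszul addnACA.
apply: big_ind => [||e _]; [exact: twt0|exact: twtD|].
apply: big_ind => [||f _]; [exact: twt0|exact: twtD|].
by apply/twtZ/twt_tens; apply: ewtM => //; apply: env_parts_wt.
Qed.

Definition coproduct_lie (x : lie k) : uenv2 := tens (inj x) 1 + tens 1 (inj x).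
Definition coproduct : U -> uenv2 := env_lift coproduct_lie.

Lemma coproduct_lie_linear : linear coproduct_lie.
Proof.
move=> c x y; rewrite /coproduct_lie linearP tens_bilin.1 tens_bilin.2.
by rewrite scalerDr addrACA.
Qed.

Lemma coproduct_lie_br p q x y : ldeg p x -> ldeg q y ->
  coproduct_lie (lbr x y) = coproduct_lie x * coproduct_lie y
    - ksign k p q *: (coproduct_lie y * coproduct_lie x).
Proof.
have h r s u v : ldeg r u -> ldeg s v -> coproduct_lie u * coproduct_lie v =
    tens (inj u * inj v) 1 + tens 1 (inj u * inj v)
    + (tens (inj u) (inj v) + ksign k r s *: tens (inj v) (inj u)).
  move=> hu hv; have [[pu pv] p1] := (parity_inj hu, parity_inj hv, parity1 k).
  rewrite /coproduct_lie mulrDl !mulrDr.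
  rewrite (tensM _ _ p1 pv) (tensM _ _ p1 p1) (tensM _ _ pu pv) (tensM _ _ pu p1).
  rewrite !andbF /= !expr0 !scale1r !mulr1 !mul1r ksignE.
  by rewrite [X in _ + X = _]addrC addrACA.
move=> hx hy; rewrite (h _ _ _ _ hx hy) (h _ _ _ _ hy hx) /coproduct_lie (inj_br hx hy).
have sg : ksign k p q * ksign k q p = 1.
  by rewrite !ksignE andbC -expr2 sqrr_sign.
rewrite !scalerDr scalerA sg scale1r.
rewrite -!scaleNr (bilDl tens_bilin) (bilDr tens_bilin) (bilZl tens_bilin) (bilZr tens_bilin).
set s := ksign k p q; rewrite [s *: tens _ _ + tens _ _]addrC.
rewrite opprD [RHS]addrACA subrr addr0 opprD [RHS]addrACA.
by rewrite !scaleNr.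
Qed.

Lemma coproduct_linear : linear coproduct.
Proof. exact/env_lift_linear/coproduct_lie_br/coproduct_lie_linear. Qed.
Lemma coproduct1 : coproduct 1 = 1.
Proof. exact/env_lift1/coproduct_lie_br/coproduct_lie_linear. Qed.
Lemma coproductM x y : coproduct (x * y) = coproduct x * coproduct y.
Proof. exact/env_liftM/coproduct_lie_br/coproduct_lie_linear. Qed.
Lemma coproduct_inj x : coproduct (inj x) = tens (inj x) 1 + tens 1 (inj x).
Proof. exact/env_lift_inj/coproduct_lie_br/coproduct_lie_linear. Qed.

Lemma coproduct_wt n x : ewt n x -> twt n (coproduct x).
Proof.
have cD y z : coproduct (y + z) = coproduct y + coproduct z.
  by rewrite -[y in LHS]scale1r coproduct_linear scale1r.
have c0 : coproduct 0 = 0 by apply: (addrI (coproduct 0)); rewrite -cD !addr0.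
elim=> {n x} [n|n x y _ hx _ hy|n c x _ hx||n x hx|m n x y _ hx _ hy].
- by rewrite c0; apply: twt0.
- by rewrite cD; apply: twtD.
- by rewrite -[c *: x]addr0 coproduct_linear c0 addr0; apply: twtZ.
- by rewrite coproduct1; apply: twt1.
- have h1 := ewt1 k; have hi := ewt_inj hx.
  rewrite coproduct_inj; apply: twtD; last exact: (twt_tens h1 hi).
  by rewrite -[n]addn0; apply: twt_tens.
- by rewrite coproductM; apply: twtM.
Qed.

End Tensor.

Record weighting (k : fieldType) (A : algType k) := Weighting {
  wcomp :> nat -> A -> Prop;
  wcomp0 : forall n, wcomp n 0;
  wcompD : forall n x y, wcomp n x -> wcomp n y -> wcomp n (x + y);
  wcompZ : forall n c x, wcomp n x -> wcomp n (c *: x);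
  wcomp1 : wcomp 0 1;
  wcompM : forall m n x y, wcomp m x -> wcomp n y -> wcomp (m + n) (x * y)
}.

Section Completion.
Variables (k : fieldType) (A : algType k) (W : weighting A).

(* The product of the weight components: families (u_n) with u_n of weight n *)
Record completion := Completion {
  ccomp :> nat -> A;
  ccompP : forall n, W n (ccomp n)
}.

HB.instance Definition _ := gen_eqMixin completion.
HB.instance Definition _ := gen_choiceMixin completion.

Lemma completionP (u v : completion) : (forall n, u n = v n) -> u = v.
Proof.
case: u v => [u hu] [v hv] /= /funext uv; case: v / uv in hv *.
by congr Completion; apply: Prop_irrelevance.
Qed.

Lemma wcomp_sum n I (r : seq I) (P : pred I) (F : I -> A) :
  (forall i, P i -> W n (F i)) -> W n (\sum_(i <- r | P i) F i).
Proof. by move=> h; apply: big_ind h; [apply: wcomp0 | apply: wcompD]. Qed.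

Lemma wcomp_conv (u v : completion) (c : nat -> k) n :
  W n (\sum_(i < n.+1) c i *: (u i * v (n - i)%N)).
Proof.
apply: wcomp_sum => i _; apply: wcompZ.
rewrite -[X in W X](subnKC (leq_ord i)).
by apply: wcompM; apply: ccompP.
Qed.

Lemma czero_subproof n : W n 0. Proof. exact: wcomp0. Qed.
Definition czero := Completion czero_subproof.
Lemma cadd_subproof (u v : completion) n : W n (u n + v n).
Proof. by apply: wcompD; apply: ccompP. Qed.
Definition cadd u v := Completion (cadd_subproof u v).
Lemma copp_subproof (u : completion) n : W n (- u n).
Proof. by rewrite -scaleN1r; apply/wcompZ/ccompP. Qed.
Definition copp u := Completion (copp_subproof u).
Lemma cone_subproof n : W n (n == 0%N)%:R.
Proof. by case: n => [|n]; [apply: wcomp1 | apply: wcomp0]. Qed.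
Definition cone := Completion cone_subproof.
Lemma cmul_subproof (u v : completion) n :
  W n (\sum_(i < n.+1) u i * v (n - i)%N).
Proof.
have := wcomp_conv u v (fun=> 1) n.
by under eq_bigr do rewrite scale1r.
Qed.
Definition cmul u v := Completion (cmul_subproof u v).

Lemma caddA : associative cadd.
Proof. by move=> u v w; apply: completionP => n; apply: addrA. Qed.
Lemma caddC : commutative cadd.
Proof. by move=> u v; apply: completionP => n; apply: addrC. Qed.
Lemma cadd0 : left_id czero cadd.
Proof. by move=> u; apply: completionP => n; apply: add0r. Qed.
Lemma caddN : left_inverse czero copp cadd.
Proof. by move=> u; apply: completionP => n; apply: addNr. Qed.
HB.instance Definition _ :=
  GRing.isZmodule.Build completion caddA caddC cadd0 caddN.

Lemma cmulE_poly (u v : completion) m n : (n <= m)%N ->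
  cmul u v n = ((\poly_(i < m.+1) u i) * (\poly_(i < m.+1) v i))`_n.
Proof.
move=> nm; rewrite coefM; apply: eq_bigr => i _; rewrite !coef_poly.
by rewrite !ltnS (leq_trans (leq_ord i) nm) (leq_trans (leq_subr _ _) nm).
Qed.

Lemma cmulA : associative cmul.
Proof.
move=> u v w; apply: completionP => n.
have := congr1 (fun p : {poly A} => p`_n)
  (mulrA (\poly_(i < n.+1) u i) (\poly_(i < n.+1) v i) (\poly_(i < n.+1) w i)).
rewrite [in X in X -> _]coefM [in X in _ = X]coefM.
under eq_bigr => i _.
  rewrite coef_poly ltnS (leq_ord i) -(cmulE_poly v w (leq_subr _ _)); over.
under [in X in _ = X]eq_bigr => i _.
  rewrite coef_poly ltnS (leq_subr i n) -(cmulE_poly u v (leq_ord i)); over.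
by [].
Qed.
Lemma cmul1 : left_id cone cmul.
Proof.
move=> u; apply: completionP => n /=; rewrite big_ord_recl /= mul1r subn0.
by rewrite big1 ?addr0 // => i _; rewrite mul0r.
Qed.
Lemma c1mul : right_id cone cmul.
Proof.
move=> u; apply: completionP => n /=; rewrite big_ord_recr /= subnn mulr1.
rewrite big1 ?add0r // => i _.
by rewrite subn_eq0 leqNgt ltn_ord mulr0.
Qed.
Lemma cmulDl : left_distributive cmul cadd.
Proof.
move=> u v w; apply: completionP => n /=; rewrite -big_split /=.
by apply: eq_bigr => i _; rewrite mulrDl.
Qed.
Lemma cmulDr : right_distributive cmul cadd.
Proof.
move=> u v w; apply: completionP => n /=; rewrite -big_split /=.
by apply: eq_bigr => i _; rewrite mulrDr.
Qed.
Lemma cone_neq0 : cone != czero.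
Proof.
by apply/eqP => /(congr1 (fun u : completion => u 0%N)) /eqP; rewrite oner_eq0.
Qed.
HB.instance Definition _ := GRing.Zmodule_isNzRing.Build completion
  cmulA cmul1 c1mul cmulDl cmulDr cone_neq0.

Lemma ccompD (u v : completion) n : (u + v) n = u n + v n.
Proof. by []. Qed.
Lemma ccomp1 n : (1 : completion) n = (n == 0%N)%:R.
Proof. by []. Qed.
Lemma ccompM (u v : completion) n :
  (u * v) n = \sum_(i < n.+1) u i * v (n - i)%N.
Proof. by []. Qed.
Lemma ccomp_sum I (r : seq I) (P : pred I) (F : I -> completion) n :
  (\sum_(i <- r | P i) F i) n = \sum_(i <- r | P i) F i n.
Proof. by elim/big_rec2: _ => // i x y _ <-. Qed.

(* The coefficient of u_i v_j in weight n = i + j is i / (i + j). For n = 0 it is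
   0 / 0 = 0, which is immaterial on elements of positive weight. *)
Lemma prec_subproof (u v : completion) n :
  W n (\sum_(i < n.+1) (i%:R / n%:R : k) *: (u i * v (n - i)%N)).
Proof. exact: (wcomp_conv u v (fun i => i%:R / n%:R)). Qed.
Definition prec (u v : completion) : completion := Completion (prec_subproof u v).

(* Right-normed powers, for n >= 1; the value at 0 is junk *)
Definition prec_pow (u : completion) (n : nat) : completion :=
  iter n.-1 (prec u) u.

(* Convergence of a series in the product topology, the weight components being
   discrete *)
Definition is_sum (f : nat -> completion) (s : completion) :=
  forall n, exists K, forall m, (K <= m)%N -> (\sum_(i < m) f i) n = s n.

Lemma is_sum_unique f s s' : is_sum f s -> is_sum f s' -> s = s'.
Proof.
move=> h h'; apply: completionP => n.
have [[K hK] [K' hK']] := (h n, h' n).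
by rewrite -(hK _ (leq_maxl K K')) (hK' _ (leq_maxr K K')).
Qed.

End Completion.

Section Hopf.
Variable k : fieldType.

Definition env_weight : weighting (uenv k) :=
  Weighting (@ewt0 k) (@ewtD k) (@ewtZ k) (@ewt1 k) (@ewtM k).
Definition env2_weight : weighting (uenv2 k) :=
  Weighting (@twt0 k) (@twtD k) (@twtZ k) (@twt1 k) (@twtM k).

(* uhat2 is the completed tensor square of uhat: its component of weight N is
   the sum of the U_i (x) U_j over the finitely many i + j = N. *)
Definition uhat := completion env_weight.
Definition uhat2 := completion env2_weight.
HB.instance Definition _ := GRing.NzRing.on uhat.
HB.instance Definition _ := GRing.NzRing.on uhat2.

Lemma ccoproduct_subproof (u : uhat) n : env2_weight n (coproduct (u n)).
Proof. exact/coproduct_wt/(ccompP u). Qed.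
Definition ccoproduct (u : uhat) : uhat2 := Completion (ccoproduct_subproof u).

(* The counit vanishes in positive weight (counit_wt), so its continuous
   extension only sees the component of weight 0. *)
Definition ccounit (u : uhat) : k := counit (u 0%N).

Lemma ctens_subproof (u v : uhat) n :
  env2_weight n (\sum_(i < n.+1) tens (u i) (v (n - i)%N)).
Proof.
apply: wcomp_sum => i _; rewrite -[X in env2_weight X](subnKC (leq_ord i)).
exact: (twt_tens (ccompP u i) (ccompP v (n - i))).
Qed.
Definition ctens (u v : uhat) : uhat2 := Completion (ctens_subproof u v).

Definition group_like (u : uhat) := ccoproduct u = ctens u u /\ ccounit u = 1.

Lemma dhat_subproof n : env_weight n (if n is 0%N then inj (ld k) else 0).
Proof.
case: n => [|n]; last exact: wcomp0.
exact/ewt_inj/(phomog_gen _ lie_gen_wt gd).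
Qed.
Definition dhat : uhat := Completion dhat_subproof.

Lemma alpha_subproof n : env_weight n (if n is 0%N then 0 else inj (la k n)).
Proof.
case: n => [|n]; first exact: wcomp0.
exact/ewt_inj/(phomog_gen _ lie_gen_wt (ga n)).
Qed.
Definition alpha : uhat := Completion alpha_subproof.

Lemma beta_subproof n : env_weight n (if n is 0%N then 0 else inj (lb k n)).
Proof.
case: n => [|n]; first exact: wcomp0.
exact/ewt_inj/(phomog_gen _ lie_gen_wt (gb n)).
Qed.
Definition beta : uhat := Completion beta_subproof.

End Hopf.

(* Main.v *)
(* Let E be the Euler derivation, multiplying the component of weight n by n.
   Then E (u ≺ v) = (E u) v, so S = 1 + sum_k β^{≺k} solves the linear equation
   E y = (E β) y, and in characteristic zero a solution of such an equation is
   determined by its component of weight 0.  Both claims are instances of this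
   uniqueness: Δ S and S ⊗ S solve E y = Δ(E β) y because the b_i are primitive
   and even, and S d and (d + α) S solve E y = (E β) y because the defining
   relations say exactly that E α = [E β, d + α]. *)
Require Import Defs.
From mathcomp Require Import all_boot all_order all_algebra.
Import GRing.Theory.
Local Open Scope ring_scope.

Set Implicit Arguments.
Unset Strict Implicit.

Section Euler.
Variables (k : fieldType) (A : algType k) (W : weighting A).
Implicit Types u v : completion W.

Lemma euler_subproof u n : W n (n%:R *: u n).
Proof. exact/wcompZ/ccompP. Qed.
Definition euler u : completion W := Completion (euler_subproof u).

Lemma eulerE u n : euler u n = n%:R *: u n.
Proof. by []. Qed.

Lemma eulerD u v : euler (u + v) = euler u + euler v.
Proof. by apply: completionP => n; apply: scalerDr. Qed.

Lemma eulerM u v : euler (u * v) = euler u * v + u * euler v.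
Proof.
apply: completionP => n; rewrite ccompD !ccompM eulerE ccompM scaler_sumr -big_split.
apply: eq_bigr => i _; rewrite /= -scalerAl -scalerAr -scalerDl -natrD.
by rewrite subnKC // leq_ord.
Qed.

Lemma euler_wt0 u : (forall n, u n.+1 = 0) -> euler u = 0.
Proof.
move=> u0; apply: completionP => -[|n]; first exact: scale0r.
by rewrite /= u0 scaler0.
Qed.

(** Indexing by the weight of the right factor lets the terms of [u * v] be matched with those of
    [v * u]. *)
Lemma ccompM_rev u v n : (u * v) n = \sum_(i < n.+1) u (n - i)%N * v i.
Proof.
rewrite ccompM (reindex_inj rev_ord_inj); apply: eq_bigr => i _ /=.
by rewrite subSS subKn ?leq_ord.
Qed.

Hypothesis k_char0 : [pchar k] =i pred0.

Lemma euler_prec u v : euler (prec u v) = euler u * v.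
Proof.
apply: completionP => n; rewrite ccompM /= scaler_sumr.
apply: eq_bigr => i _; rewrite scalerA -scalerAl.
(* In weight 0 both scalars vanish, so the junk value 0 / 0 does no harm. *)
case: n i => [|n] i; first by case: i => -[|//] ?; rewrite !mul0r.
by rewrite mulrC divfK // ((pcharf0P _).1 k_char0).
Qed.

(** Since c has no component of weight 0, the equation in weight n > 0 expresses n y_n through
    components of y of lower weight, and n is invertible. *)
Lemma euler_unique (c y z : completion W) : c 0%N = 0 ->
  euler y = c * y -> euler z = c * z -> y 0%N = z 0%N -> y = z.
Proof.
move=> c0 ey ez yz; apply: completionP => n.
elim/ltn_ind: n => -[//|n] IHn.
suff /(scalerI _) : n.+1%:R *: y n.+1 = n.+1%:R *: z n.+1.
  by apply; rewrite ((pcharf0P _).1 k_char0).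
rewrite -[LHS]/(euler y n.+1) -[RHS]/(euler z n.+1) ey ez !ccompM.
rewrite big_ord_recl [RHS]big_ord_recl c0 !mul0r; congr (_ + _).
by apply: eq_bigr => i _; rewrite IHn // ltn_subrL.
Qed.

End Euler.

Section PrecSeries.
Variables (k : fieldType) (A : algType k) (W : weighting A).
Variables (u : completion W).
Hypothesis u0 : u 0%N = 0.

(** As u starts in weight 1, its power of exponent m + 1 starts in weight m + 1, which makes the
    series of powers locally finite. *)
Lemma prec_pow_low m n : (n <= m)%N -> prec_pow u m.+1 n = 0.
Proof.
elim: m n => [|m IHm] n; first by rewrite leqn0 => /eqP ->.
(* The term i = 0 dies by its coefficient; in the others the right factor has weight at most m. *)
move=> nm; rewrite /prec_pow /= big1 // => -[[|i] ?] _ /=.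
  by rewrite mul0r scale0r.
rewrite -/(prec_pow u m.+1) IHm ?mulr0 ?scaler0 // leq_subLR (leq_trans nm) //.
by rewrite addSn ltnS leq_addl.
Qed.

Lemma sum_prec_pow m n : (n <= m)%N ->
  \sum_(i < m) prec_pow u i.+1 n = \sum_(i < n) prec_pow u i.+1 n.
Proof.
move=> nm; rewrite -(subnKC nm) big_split_ord /= [X in _ + X]big1 ?addr0 // => i _.
by rewrite prec_pow_low // leq_addr.
Qed.

Lemma prec_series_subproof n : W n (\sum_(i < n) prec_pow u i.+1 n).
Proof. by apply: wcomp_sum => i _; apply: ccompP. Qed.
Definition prec_series : completion W := Completion prec_series_subproof.

Lemma is_sum_prec_series : is_sum (fun i => prec_pow u i.+1) prec_series.
Proof. by move=> n; exists n => m nm; rewrite ccomp_sum sum_prec_pow. Qed.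

(** By [euler_prec], E sends each power after the first to E u times the preceding one, so applying
    E shifts the partial sums by one. *)
Lemma euler_prec_series : [pchar k] =i pred0 ->
  euler (1 + prec_series) = euler u * (1 + prec_series).
Proof.
move=> k0; rewrite eulerD euler_wt0 // add0r.
have eT m : euler (\sum_(i < m.+1) prec_pow u i.+1) =
    euler u * (1 + \sum_(i < m) prec_pow u i.+1).
  elim: m => [|m IHm]; first by rewrite big_ord1 big_ord0 addr0 mulr1.
  rewrite big_ord_recr eulerD IHm /= -[prec_pow u m.+2]/(prec u (prec_pow u m.+1)).
  by rewrite (euler_prec k0) -mulrDr -addrA big_ord_recr.
apply: completionP => n.
(* Of n + 1 powers the shift leaves n, enough for all weights up to n. *)
transitivity (euler (\sum_(i < n.+1) prec_pow u i.+1) n).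
  by rewrite !eulerE ccomp_sum sum_prec_pow.
rewrite eT !ccompM; apply: eq_bigr => i _; congr (_ * _).
by rewrite !ccompD ccomp_sum sum_prec_pow // leq_subr.
Qed.

End PrecSeries.

Section Coproduct.
Variable k : fieldType.
Implicit Types u v w : uhat k.

(** The sign rule [tensM] needs c homogeneous, hence the splitting by parity; the factor 1 is even,
    so no sign appears. *)
Lemma tensMl (a c d : uenv k) : tens a 1 * tens c d = tens (a * c) d.
Proof.
rewrite -[c]env_parts_sum mulr_sumr !(bil_suml (tens_bilin k)) mulr_sumr.
apply: eq_bigr => e _; rewrite (tensM _ _ (parity1 k) (parity_parts e c)).
by rewrite expr0 scale1r mul1r.
Qed.

Lemma tensMr (b c d : uenv k) : has_parity false b ->
  tens 1 b * tens c d = tens c (b * d).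
Proof.
move=> hb; rewrite -[c]env_parts_sum !(bil_suml (tens_bilin k)) mulr_sumr.
apply: eq_bigr => e _; rewrite (tensM _ _ hb (parity_parts e c)).
by rewrite expr0 scale1r mul1r.
Qed.

Lemma ctens1r u n : ctens u 1 n = tens (u n) 1.
Proof.
rewrite /= big_ord_recr /= subnn big1 ?add0r // => i _.
by rewrite subn_eq0 leqNgt ltn_ord (bil0r (tens_bilin k)).
Qed.

Lemma ctens1l u n : ctens 1 u n = tens 1 (u n).
Proof.
rewrite /= big_ord_recl /= subn0 big1 ?addr0 // => i _.
exact: (bil0l (tens_bilin k)).
Qed.

(** This reduces multiplicativity of [ctens] to one-sided tensors. *)
Lemma ctensE u v : ctens u v = ctens u 1 * ctens 1 v.
Proof.
apply: completionP => n; rewrite ccompM; apply: eq_bigr => i _.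
by rewrite ctens1r ctens1l tensMl mulr1.
Qed.

Lemma ctensMl u v w : ctens (u * v) w = ctens u 1 * ctens v w.
Proof.
rewrite (ctensE (u * v)) (ctensE v) mulrA; congr (_ * _).
apply: completionP => n; rewrite ctens1r !ccompM (bil_suml (tens_bilin k)).
by apply: eq_bigr => i _; rewrite !ctens1r tensMl.
Qed.

Lemma ctensMr u v w : (forall n, has_parity false (u n)) ->
  ctens v (u * w) = ctens 1 u * ctens v w.
Proof.
move=> hu; rewrite (ctensE v (u * w)) (ctensE v w) mulrA.
have -> : ctens 1 (u * w) = ctens 1 u * ctens 1 w.
  apply: completionP => n; rewrite ctens1l !ccompM (bil_sumr (tens_bilin k)).
  by apply: eq_bigr => i _; rewrite !ctens1l tensMr.
(* It remains to commute 1 ⊗ u with v ⊗ 1, which costs no sign because u is even. *)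
rewrite mulrA; congr (_ * _); rewrite -ctensE.
apply: completionP => n; rewrite ccompM_rev; apply: eq_bigr => i _.
by rewrite ctens1l ctens1r tensMr ?mulr1.
Qed.

Lemma euler_ctens u v :
  euler (ctens u v) = ctens (euler u) v + ctens u (euler v).
Proof.
apply: completionP => n; rewrite ccompD /= scaler_sumr -big_split.
apply: eq_bigr => i _ /=.
rewrite (bilZl (tens_bilin k)) (bilZr (tens_bilin k)) -scalerDl -natrD.
by rewrite subnKC // leq_ord.
Qed.

Lemma coproductD (x y : uenv k) : coproduct (x + y) = coproduct x + coproduct y.
Proof. by rewrite -[x in LHS]scale1r coproduct_linear scale1r. Qed.

Lemma coproduct0 : coproduct (0 : uenv k) = 0.
Proof. by apply: (addrI (coproduct 0)); rewrite -coproductD !addr0. Qed.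

Lemma coproductZ c (x : uenv k) : coproduct (c *: x) = c *: coproduct x.
Proof. by rewrite -[c *: x]addr0 coproduct_linear coproduct0 addr0. Qed.

Lemma ccoproductE u n : ccoproduct u n = coproduct (u n).
Proof. by []. Qed.

Lemma ccoproductM u v : ccoproduct (u * v) = ccoproduct u * ccoproduct v.
Proof.
apply: completionP => n; rewrite ccoproductE !ccompM.
rewrite (big_morph _ coproductD coproduct0).
by apply: eq_bigr => i _; apply: coproductM.
Qed.

Lemma euler_ccoproduct u : euler (ccoproduct u) = ccoproduct (euler u).
Proof. by apply: completionP => n; rewrite /= coproductZ. Qed.

End Coproduct.

Section Generators.
Variable k : fieldType.

(** Writing each component as the image of a Lie element gives both its parity and its coproduct. *)
Lemma euler_beta n :
  euler (beta k) n = inj (n%:R *: if n is 0%N then 0 else lb k n).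
Proof. by rewrite linearZ eulerE; case: n => [|n] /=; rewrite ?linear0. Qed.

Lemma lb_deg n : ldeg 0 (lb k n).
Proof. exact: (phomog_gen _ lie_gen_deg (gb n.-1)). Qed.

Lemma parity_euler_beta n : has_parity false (euler (beta k) n).
Proof.
rewrite euler_beta; apply: (@parity_inj k 0); apply: phomogZ.
by case: n => [|n]; [apply: phomog0 | apply: lb_deg].
Qed.

Lemma ccoproduct_euler_beta :
  ccoproduct (euler (beta k)) = ctens (euler (beta k)) 1 + ctens 1 (euler (beta k)).
Proof.
apply: completionP => n; rewrite ccompD ctens1r ctens1l.
by rewrite -[LHS]/(coproduct (euler (beta k) n)) euler_beta coproduct_inj.
Qed.

Lemma inj_br_lb n x : ldeg (-1) x ->
  inj (lbr (lb k n) x) = inj (lb k n) * inj x - inj x * inj (lb k n).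
Proof. by move=> hx; rewrite (inj_br (lb_deg n) hx) /ksign mul0r expr0z scale1r. Qed.

(** In weight n > 0 this is n times the defining relation: the coefficient i / n becomes i, that of
    b_i in E β. *)
Lemma euler_alpha : [pchar k] =i pred0 ->
  euler (alpha k) + (dhat k + alpha k) * euler (beta k) =
  euler (beta k) * (dhat k + alpha k).
Proof.
move=> k0; apply: completionP => -[|n].
  by rewrite ccompD !ccompM !big_ord1 /= !scale0r mulr0 mul0r addr0.
have la_deg m : ldeg (-1) (la k m) by exact: (phomog_gen _ lie_gen_deg (ga m.-1)).
have ld_deg : ldeg (-1) (ld k) by exact: (phomog_gen _ lie_gen_deg gd).
have n0 : n.+1%:R != 0 :> k by rewrite ((pcharf0P _).1 k0).
have def_a : euler (alpha k) n.+1 = n.+1%:R *: inj (lbr (lb k n.+1) (ld k)) +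
    \sum_(i < n) i.+1%:R *: inj (lbr (lb k i.+1) (la k (n - i))).
  rewrite lbr_defining // linearB linear_sum /= scalerBr scaler_sumr big_add1 big_mkord.
  under [X in _ - X + _]eq_bigr => i _ do
    rewrite linearZ /= scalerA mulrC divfK // subSS.
  by rewrite subrK.
rewrite ccompD def_a [in LHS]ccompM_rev [in RHS]ccompM.
(* The difference of the two products is a sum of commutators. Its first term vanishes, E β having
   no weight 0, and its last one involves only d. *)
apply/eqP; rewrite eq_sym -subr_eq -sumrB big_ord_recl big_ord_recr /=.
rewrite subnn !scale0r mul0r mulr0 subrr add0r addrC addr0.
rewrite inj_br_lb // scalerBr scalerAl scalerAr; apply/eqP; congr (_ + _).
(* Exposing n - i as a successor reduces the component of d + α to a_(n-i). *)
apply: eq_bigr => i _; rewrite subSS -[(n - i)%N](prednK _) ?subn_gt0 //=.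
by rewrite !add0r inj_br_lb // scalerBr scalerAl scalerAr.
Qed.

End Generators.

Unset Implicit Arguments.

Theorem theorem3p7 (k : fieldType) (k_char0 : [pchar k] =i pred0) :
  exists s : uhat k,
    [/\ is_sum (fun i => prec_pow (beta k) i.+1) s,
        group_like (1 + s)
      & (1 + s) * dhat k = (dhat k + alpha k) * (1 + s)].
Proof.
exists (prec_series (beta k)).
set S := 1 + _.
have eS : euler S = euler (beta k) * S by apply: euler_prec_series.
have S0 : S 0%N = 1 by rewrite ccompD /= big_ord0 addr0.
have b0 : euler (beta k) 0%N = 0 by apply: scale0r.
split; first exact: is_sum_prec_series.
- split; last exact: etrans (congr1 (@counit k) S0) (counit1 k).
  apply: (euler_unique k_char0 (c := ccoproduct (euler (beta k)))).
  + by rewrite ccoproductE b0 coproduct0.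
  + by rewrite euler_ccoproduct eS ccoproductM.
  (* E β ⊗ 1 and 1 ⊗ E β both factor out on the left of S ⊗ S, the latter by evenness. *)
  + rewrite euler_ctens eS ctensMl ctensMr; last exact: parity_euler_beta.
    by rewrite -mulrDl ccoproduct_euler_beta.
  + by rewrite ccoproductE S0 coproduct1 ctensE ccompM big_ord1 ctens1r ctens1l S0 mulr1.
- apply: (euler_unique k_char0 (c := euler (beta k))) => //.
  + by rewrite eulerM eS (@euler_wt0 _ _ _ (dhat k)) // mulr0 addr0 mulrA.
  (* As E d = 0, the left side is (E α + (d + α) E β) S. *)
  + rewrite eulerM eulerD (@euler_wt0 _ _ _ (dhat k)) // add0r eS !mulrA -mulrDl.
    by rewrite euler_alpha.
  (* In weight 0 both sides equal d, since α starts in weight 1. *)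
  + by rewrite !ccompM !big_ord1 S0 ccompD /= mul1r mulr1 addr0.
Qed.
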